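(* The forgetful functor $\Phi:\mathsf{Quad}\to\mathsf{Nil}(2)$, which sends a quadratic module $(\omega,\delta,\partial)$ with $C\otimes C\xrightarrow{\omega}L\xrightarrow{\delta}M\xrightarrow{\partial}N$ to its base nil(2)-module $(\partial:M\to N)$ and a morphism $(l,m,n)$ to $(m,n)$, is a fibration of categories, and it has a left adjoint.
   Context: All group actions are right actions, and groups are written multiplicatively; $[a,b]=a^{-1}b^{-1}ab$. A pre-crossed module is a group homomorphism $\partial:M\to N$ with an action of $N$ on $M$ by automorphisms, written $m^n$, such that $\partial(m^n)=n^{-1}\partial(m)n$. The Peiffer commutator of $x,y\in M$ is $\langle x,y\rangle=x^{-1}y^{-1}x\,y^{\partial x}$. A nil(2)-module is a pre-crossed module with $P_3(\partial)=1$, where $P_3(\partial)$ is the subgroup of $M$ generated by the Peiffer commutators of length 3 (iterated Peiffer commutators $\langle\langle x_1,x_2\rangle,x_3\rangle$ and $\langle x_1,\langle x_2,x_3\rangle\rangle$, $x_i\in M$). A morphism of nil(2)-modules $(m,n):(\partial:M\to N)\to(\partial':M'\to N')$ is a pair of group homomorphisms $m:M\to M'$, $n:N\to N'$ with $n\partial=\partial'm$ and $m(x^{g})=m(x)^{n(g)}$ for all $x\in M$, $g\in N$. This defines the category $\mathsf{Nil}(2)$. For a nil(2)-module $\partial:M\to N$, let $M^{cr}$ be the quotient of $M$ by the normal subgroup generated by all Peiffer commutators, let $C=(M^{cr})^{ab}$ be its abelianization, and let $q:M\to C$, $x\mapsto q(x)=\{x\}$, be the projection. The group $C\otimes C$ (tensor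 product of abelian groups) carries the diagonal $N$-action, and $w:C\otimes C\to M$ is the homomorphism $w(\{x\}\otimes\{y\})=\langle x,y\rangle$. A quadratic module $(\omega,\delta,\partial)$ consists of a nil(2)-module $\partial:M\to N$, a group $L$ with an action of $N$, and $N$-equivariant homomorphisms $\omega:C\otimes C\to L$, $\delta:L\to M$ such that for all $a,b\in L$, $x,y\in M$: (QM1) $\partial\delta=1$; (QM2) $\delta\omega(\{x\}\otimes\{y\})=w(\{x\}\otimes\{y\})=\langle x,y\rangle$; (QM3) $\omega\big((\{\delta a\}\otimes\{x\})(\{x\}\otimes\{\delta a\})\big)=a^{-1}a^{\partial x}$, where the product is taken in $C\otimes C$; (QM4) $\omega(\{\delta a\}\otimes\{\delta b\})=[a,b]$. A morphism $(l,m,n):(\omega,\delta,\partial)\to(\omega',\delta',\partial')$ consists of a morphism $(m,n)$ of the underlying pre-crossed modules, inducing $\varphi_*:C\to C'$, and an $n$-equivariant homomorphism $l:L\to L'$ with $l\omega=\omega'(\varphi_*\otimes\varphi_* )$ and $\delta'l=m\delta$. This defines the category $\mathsf{Quad}$. Let $\Phi:\mathsf X\to\mathsf B$ be a functor. A morphism $\varphi:Y\to X$ in $\mathsf X$ over $u=\Phi(\varphi):J\to I$ is cartesian if for all $\upsilon:K\to J$ in $\mathsf B$ and $\theta:Z\to X$ with $\Phi(\theta)=u\upsilon$ there is a unique $\psi:Z\to Y$ with $\Phi(\psi)=\upsilon$ and $\theta=\varphi\psi$. The functor $\Phi$ is a fibration (is fibred) if for every $u:J\to I$ in $\mathsf B$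 and every object $X$ with $\Phi(X)=I$ there is a cartesian morphism $\varphi:Y\to X$ over $u$. *)

(* Defs.v *)
From HB Require Import structures.
From mathcomp Require Import all_boot boolp.

Set Implicit Arguments.
Unset Strict Implicit.
Unset Printing Implicit Defensive.

Local Open Scope group_scope.
Local Open Scope quotient_scope.

(* Possibly infinite groups are [groupType]; {ghom G -> H} is the library's
   type of group homomorphisms. *)
Notation "{ 'ghom' G -> H }" := (UMagmaMorphism.type G H)
  (at level 0, G at level 98, H at level 99,
   format "{ 'ghom'  G  ->  H }") : type_scope.

Section GroupHom.
Variables (G H : groupType) (f : G -> H) (fM : {morph f : x y / x * y}).

Let ghomF : {morph f : x y / x / y}.
Proof.
have f1 : f 1 = 1 by apply: (mulgI (f 1)); rewrite -fM !mulg1.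
move=> x y; rewrite fM; congr (_ * _).
by apply: (mulgI (f y)); rewrite -fM !mulgV.
Qed.

HB.instance Definition _ := isGroupMorphism.Build G H f ghomF.
Definition ghom_of : {ghom G -> H} := f.

Lemma ghom_ofE x : ghom_of x = f x. Proof. by []. Qed.
End GroupHom.

Lemma ghom_eq (G H : groupType) (f g : {ghom G -> H}) : f =1 g -> f = g.
Proof.
case: f g => [f [[fa] [fb]]] [g [[ga] [gb]]] /= /funext fg.
by subst g; congr (UMagmaMorphism.Pack (UMagmaMorphism.Class _ _));
  congr (_ _); apply: Prop_irrelevance.
Qed.

Definition ghom_id (G : groupType) : {ghom G -> G} := idfun.
Definition ghom_comp (G H K : groupType) (g : {ghom H -> K}) (f : {ghom G -> H}) :
  {ghom G -> K} := g \o f.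

Lemma ghom_compE (G H K : groupType) (g : {ghom H -> K}) (f : {ghom G -> H}) x :
  ghom_comp g f x = g (f x).
Proof. by []. Qed.

Section Generation.
Variables (G : groupType) (S : G -> Prop).

(* The subgroup of G generated by S. *)
Inductive subgroup_gen : G -> Prop :=
  | sg_gen x : S x -> subgroup_gen x
  | sg_one : subgroup_gen 1
  | sg_mul x y : subgroup_gen x -> subgroup_gen y -> subgroup_gen (x * y)
  | sg_inv x : subgroup_gen x -> subgroup_gen x^-1.

(* The normal subgroup of G generated by S. *)
Inductive normal_gen : G -> Prop :=
  | ng_gen x : S x -> normal_gen x
  | ng_one : normal_gen 1
  | ng_mul x y : normal_gen x -> normal_gen y -> normal_gen (x * y)
  | ng_inv x : normal_gen x -> normal_gen x^-1
  | ng_conj x y : normal_gen x -> normal_gen (x ^ y).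

Definition quotg_rel (x y : G) : bool := `[< normal_gen (x^-1 * y) >].

Lemma quotg_relP : equiv_class_of quotg_rel.
Proof.
split=> [x|x y|y x z].
- by apply/asboolP; rewrite mulVg; apply: ng_one.
- by apply/asboolP/asboolP => /ng_inv; rewrite invgM invgK.
- move=> /asboolP xy /asboolP yz; apply/asboolP.
  by have := ng_mul xy yz; rewrite mulgA mulgK.
Qed.
Canonical quotg_equiv := EquivRelPack quotg_relP.
End Generation.

(* The quotient of G by the normal subgroup generated by S. *)
Definition quotg_sort (G : groupType) (S : G -> Prop) := {eq_quot (quotg_rel S)}.

Section QuotientGroup.
Variables (G : groupType) (S : G -> Prop).
Local Notation Q := (quotg_sort S).

HB.instance Definition _ := Choice.on Q.

Definition qpi (x : G) : Q := \pi_({eq_quot (quotg_rel S)}) x.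
Definition qrepr (c : Q) : G := repr (c : {eq_quot (quotg_rel S)}).

Lemma qreprK c : qpi (qrepr c) = c. Proof. exact: reprK. Qed.

Lemma qpiP x y : qpi x = qpi y <-> normal_gen S (x^-1 * y).
Proof.
split=> [/eqmodP/asboolP//|xy]; exact/eqmodP/asboolP.
Qed.

Definition quotg_mul (c d : Q) : Q := qpi (qrepr c * qrepr d).
Definition quotg_inv (c : Q) : Q := qpi (qrepr c)^-1.

Lemma qpiM x y : qpi (x * y) = quotg_mul (qpi x) (qpi y).
Proof.
have /qpiP xP : qpi x = qpi (qrepr (qpi x)) by rewrite qreprK.
have /qpiP yP : qpi y = qpi (qrepr (qpi y)) by rewrite qreprK.
apply/qpiP; have := ng_mul (ng_conj y xP) yP.
by rewrite conjgE invgM !mulgA mulgK.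
Qed.

Lemma qpiV x : qpi x^-1 = quotg_inv (qpi x).
Proof.
have /qpiP xP : qpi x = qpi (qrepr (qpi x)) by rewrite qreprK.
apply/qpiP; have := ng_conj x^-1 (ng_inv xP).
by rewrite conjgE !invgM !invgK !mulgA mulgK.
Qed.

Fact quotg_mulA : associative quotg_mul.
Proof.
by move=> a b c; rewrite -[a]qreprK -[b]qreprK -[c]qreprK -!qpiM mulgA.
Qed.
Fact quotg_mul1 : left_id (qpi 1) quotg_mul.
Proof. by move=> a; rewrite -[a]qreprK -qpiM mul1g. Qed.
Fact quotg_1mul : right_id (qpi 1) quotg_mul.
Proof. by move=> a; rewrite -[a]qreprK -qpiM mulg1. Qed.
Fact quotg_mulV : left_inverse (qpi 1) quotg_inv quotg_mul.
Proof. by move=> a; rewrite -[a]qreprK -qpiV -qpiM mulVg. Qed.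
Fact quotg_Vmul : right_inverse (qpi 1) quotg_inv quotg_mul.
Proof. by move=> a; rewrite -[a]qreprK -qpiV -qpiM mulgV. Qed.

HB.instance Definition _ := isGroup.Build Q
  quotg_mulA quotg_mul1 quotg_1mul quotg_mulV quotg_Vmul.

Definition quotg : groupType := Q.

Definition quotg_pi : {ghom G -> quotg} := ghom_of qpiM.

Lemma quotg_piP x y : quotg_pi x = quotg_pi y <-> normal_gen S (x^-1 * y).
Proof. exact: qpiP. Qed.

Lemma quotg_ind (P : quotg -> Prop) : (forall x, P (quotg_pi x)) -> forall c, P c.
Proof. by move=> Ppi c; rewrite -[c]qreprK; apply: Ppi. Qed.

Lemma quotg_pi1 x : S x -> quotg_pi x = 1.
Proof.
by move=> Sx; apply/esym/quotg_piP; rewrite invg1 mul1g; apply: ng_gen.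
Qed.

Section Lift.
Variables (K : groupType) (f : {ghom G -> K}) (f1 : forall x, S x -> f x = 1).

Lemma normal_gen_ker x : normal_gen S x -> f x = 1.
Proof.
elim=> {x} [x /f1//||x y _ fx _ fy|x _ fx|x y _ fx].
- exact: gmulf1.
- by rewrite gmulfM fx fy mulg1.
- by rewrite gmulfV fx invg1.
- by rewrite gmulfJ fx conj1g.
Qed.

Lemma quotg_liftE x : f (qrepr (qpi x)) = f x.
Proof.
have /qpiP/normal_gen_ker : qpi x = qpi (qrepr (qpi x)) by rewrite qreprK.
by rewrite gmulfM gmulfV => h; apply: (mulgI (f x)^-1); rewrite h mulVg.
Qed.

Fact quotg_liftM : {morph f \o qrepr : c d / c * d}.
Proof.
by elim/quotg_ind=> x; elim/quotg_ind=> y; rewrite -gmulfM /= !quotg_liftE gmulfM.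
Qed.

Definition quotg_lift : {ghom quotg -> K} := ghom_of quotg_liftM.

Lemma quotg_lift_pi x : quotg_lift (quotg_pi x) = f x.
Proof. exact: quotg_liftE. Qed.
End Lift.
End QuotientGroup.

Arguments quotg_pi {G S}.

(* The tensor product of abelian groups, written multiplicatively and presented
   by generators a (x) b and relations. It is only meant for abelian A and B:
   otherwise the relations give the tensor product of the abelianizations. *)
Section Tensor.
Variables (A B : groupType).

Inductive tens_term :=
  | TGen of A & B
  | TOne
  | TMul of tens_term & tens_term
  | TInv of tens_term.

Inductive tens_eq : tens_term -> tens_term -> Prop :=
  | te_refl t : tens_eq t t
  | te_sym t u : tens_eq t u -> tens_eq u t
  | te_trans t u v : tens_eq t u -> tens_eq u v -> tens_eq t v
  | te_mul t t' u u' :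
      tens_eq t t' -> tens_eq u u' -> tens_eq (TMul t u) (TMul t' u')
  | te_inv t t' : tens_eq t t' -> tens_eq (TInv t) (TInv t')
  | te_mulA t u v : tens_eq (TMul t (TMul u v)) (TMul (TMul t u) v)
  | te_mul1 t : tens_eq (TMul TOne t) t
  | te_mulV t : tens_eq (TMul (TInv t) t) TOne
  | te_mulC t u : tens_eq (TMul t u) (TMul u t)
  | te_genl a a' b : tens_eq (TGen (a * a') b) (TMul (TGen a b) (TGen a' b))
  | te_genr a b b' : tens_eq (TGen a (b * b')) (TMul (TGen a b) (TGen a b')).

HB.instance Definition _ := gen_eqMixin tens_term.
HB.instance Definition _ := gen_choiceMixin tens_term.

Definition tens_rel (t u : tens_term) : bool := `[< tens_eq t u >].

Lemma tens_relP : equiv_class_of tens_rel.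
Proof.
split=> [x|x y|y x z].
- exact/asboolP/te_refl.
- by apply/asboolP/asboolP; apply: te_sym.
- by move=> /asboolP xy /asboolP yz; apply/asboolP/(te_trans xy yz).
Qed.
Canonical tens_equiv := EquivRelPack tens_relP.

Definition tensor_sort := {eq_quot tens_rel}.
HB.instance Definition _ := Choice.on tensor_sort.

Definition tens_pi (t : tens_term) : tensor_sort := \pi_({eq_quot tens_rel}) t.
Definition tens_repr (c : tensor_sort) : tens_term := repr (c : {eq_quot tens_rel}).

Lemma tens_reprK c : tens_pi (tens_repr c) = c. Proof. exact: reprK. Qed.
Lemma tens_piP t u : tens_pi t = tens_pi u <-> tens_eq t u.
Proof. by split=> [/eqmodP/asboolP//|tu]; apply/eqmodP/asboolP. Qed.

Lemma tens_piK t : tens_eq (tens_repr (tens_pi t)) t.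
Proof. by apply/tens_piP; rewrite tens_reprK. Qed.

Definition tens_mul (c d : tensor_sort) := tens_pi (TMul (tens_repr c) (tens_repr d)).
Definition tens_inv (c : tensor_sort) := tens_pi (TInv (tens_repr c)).

Lemma tens_piM t u : tens_pi (TMul t u) = tens_mul (tens_pi t) (tens_pi u).
Proof. by apply/tens_piP/te_mul; apply/te_sym/tens_piK. Qed.
Lemma tens_piV t : tens_pi (TInv t) = tens_inv (tens_pi t).
Proof. by apply/tens_piP/te_inv/te_sym/tens_piK. Qed.

Fact tens_mulA : associative tens_mul.
Proof.
move=> a b c; rewrite -[a]tens_reprK -[b]tens_reprK -[c]tens_reprK -!tens_piM.
exact/tens_piP/te_mulA.
Qed.
Fact tens_mulC : commutative tens_mul.
Proof.
move=> a b; rewrite -[a]tens_reprK -[b]tens_reprK -!tens_piM.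
exact/tens_piP/te_mulC.
Qed.
Fact tens_mul1 : left_id (tens_pi TOne) tens_mul.
Proof. by move=> a; rewrite -[a]tens_reprK -tens_piM; apply/tens_piP/te_mul1. Qed.
Fact tens_1mul : right_id (tens_pi TOne) tens_mul.
Proof. by move=> a; rewrite tens_mulC tens_mul1. Qed.
Fact tens_mulV : left_inverse (tens_pi TOne) tens_inv tens_mul.
Proof.
by move=> a; rewrite -[a]tens_reprK -tens_piV -tens_piM; apply/tens_piP/te_mulV.
Qed.
Fact tens_Vmul : right_inverse (tens_pi TOne) tens_inv tens_mul.
Proof. by move=> a; rewrite tens_mulC tens_mulV. Qed.

HB.instance Definition _ := isGroup.Build tensor_sort
  tens_mulA tens_mul1 tens_1mul tens_mulV tens_Vmul.

Definition tensor : groupType := tensor_sort.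

Definition tens (a : A) (b : B) : tensor := tens_pi (TGen a b).

Lemma tensorC (s t : tensor) : s * t = t * s.
Proof. exact: tens_mulC. Qed.
Lemma tensMl a a' b : tens (a * a') b = tens a b * tens a' b.
Proof. by apply: etrans (tens_piM _ _); apply/tens_piP/te_genl. Qed.
Lemma tensMr a b b' : tens a (b * b') = tens a b * tens a b'.
Proof. by apply: etrans (tens_piM _ _); apply/tens_piP/te_genr. Qed.

Lemma tensor_ind (P : tensor -> Prop) :
    (forall a b, P (tens a b)) -> P 1 ->
    (forall s t, P s -> P t -> P (s * t)) -> (forall t, P t -> P t^-1) ->
  forall t, P t.
Proof.
move=> Pg P1 PM PV t; rewrite -[t]tens_reprK.
elim: (tens_repr t) => {t} [a b||t Pt u Pu|t Pt]; first exact: Pg.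
- exact: P1.
- by rewrite tens_piM; apply: PM.
- by rewrite tens_piV; apply: PV.
Qed.

Lemma tensor_ext (K : groupType) (f g : {ghom tensor -> K}) :
  (forall a b, f (tens a b) = g (tens a b)) -> f =1 g.
Proof.
move=> fg; elim/tensor_ind=> [//||s t fs ft|t ft]; first by rewrite !gmulf1.
- by rewrite !gmulfM fs ft.
- by rewrite !gmulfV ft.
Qed.

Section Lift.
Variables (K : groupType) (beta : A -> B -> K).
Hypothesis betaMl : forall a a' b, beta (a * a') b = beta a b * beta a' b.
Hypothesis betaMr : forall a b b', beta a (b * b') = beta a b * beta a b'.
Hypothesis betaC : forall a b a' b', commute (beta a b) (beta a' b').

Fixpoint tens_eval (t : tens_term) : K :=
  match t with
  | TGen a b => beta a b
  | TOne => 1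
  | TMul t u => tens_eval t * tens_eval u
  | TInv t => (tens_eval t)^-1
  end.

Lemma tens_evalC t u : commute (tens_eval t) (tens_eval u).
Proof.
elim: t => [a b||t IHt t' IHt'|t IHt] /=.
- elim: u => [a' b'||u IHu u' IHu'|u IHu] /=; first exact: betaC.
  + exact: commute1.
  + exact: commuteM.
  + exact: commuteV.
- exact/commute_sym/commute1.
- by apply/commute_sym/commuteM; apply: commute_sym.
- by apply/commute_sym/commuteV/commute_sym.
Qed.

Lemma tens_eval_eq t u : tens_eq t u -> tens_eval t = tens_eval u.
Proof.
elim=> {t u} //= [t u v _ -> _ -> //|t t' u u' _ -> _ -> //|t t' _ -> //|t u v|t|t|t u].
- exact: mulgA.
- exact: mul1g.
- exact: mulVg.
- exact: tens_evalC.
Qed.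

Fact tensor_liftM : {morph tens_eval \o tens_repr : s t / s * t}.
Proof. by move=> s t /=; rewrite (tens_eval_eq (tens_piK _)). Qed.

Definition tensor_lift : {ghom tensor -> K} := ghom_of tensor_liftM.

Lemma tensor_liftE a b : tensor_lift (tens a b) = beta a b.
Proof. exact: (tens_eval_eq (tens_piK _)). Qed.
End Lift.
End Tensor.

Arguments tens {A B}.

Section TensorMap.
Variables (A B A' B' : groupType) (f : {ghom A -> A'}) (g : {ghom B -> B'}).

Definition tensor_map : {ghom tensor A B -> tensor A' B'}.
Proof.
apply: (@tensor_lift A B (tensor A' B') (fun a b => tens (f a) (g b))).
- by move=> a a' b; rewrite gmulfM tensMl.
- by move=> a b b'; rewrite gmulfM tensMr.
- by move=> a b a' b'; apply: tensorC.
Defined.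

Lemma tensor_mapE a b : tensor_map (tens a b) = tens (f a) (g b).
Proof. exact: tensor_liftE. Qed.
End TensorMap.

(* Right actions of N on M by group automorphisms. *)
Record gaction (N M : groupType) := GAction {
  gact :> M -> N -> M;
  gact1 : forall x, gact x 1 = x;
  gactM : forall x g h, gact x (g * h) = gact (gact x g) h;
  gactMl : forall x y g, gact (x * y) g = gact x g * gact y g
}.

Record precrossed := PreCrossed {
  pcM : groupType;
  pcN : groupType;
  bd : {ghom pcM -> pcN};
  pcact : gaction pcN pcM;
  bd_act : forall x g, bd (pcact x g) = g^-1 * bd x * g
}.
Arguments bd {p}.
Arguments pcact {p}.
Arguments bd_act {p}.

Definition peiffer (D : precrossed) (x y : pcM D) : pcM D :=
  x^-1 * y^-1 * x * pcact y (bd x).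

Inductive peiffer3 (D : precrossed) : pcM D -> Prop :=
  | peiffer3l x y z : peiffer3 (peiffer (peiffer x y) z)
  | peiffer3r x y z : peiffer3 (peiffer x (peiffer y z)).

Definition P3 (D : precrossed) : pcM D -> Prop := subgroup_gen (@peiffer3 D).

Record nil2 := Nil2Module {
  nil2_pc :> precrossed;
  nil2_P3 : forall x : pcM nil2_pc, P3 x -> x = 1
}.

Record pcmor (D D' : precrossed) := PCMor {
  morM : {ghom pcM D -> pcM D'};
  morN : {ghom pcN D -> pcN D'};
  mor_bd : forall x, morN (bd x) = bd (morM x);
  mor_act : forall x g, morM (pcact x g) = pcact (morM x) (morN g)
}.

Lemma pcmor_eq D D' (f f' : pcmor D D') :
  morM f =1 morM f' -> morN f =1 morN f' -> f = f'.
Proof.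
case: f f' => [m n b a] [m' n' b' a'] /= /ghom_eq mm /ghom_eq nn.
by subst m' n'; congr PCMor; apply: Prop_irrelevance.
Qed.

Definition pcmor_id (D : precrossed) : pcmor D D.
Proof. by apply: (@PCMor D D (ghom_id _) (ghom_id _)). Defined.

Definition pcmor_comp (D D' D'' : precrossed) (g : pcmor D' D'') (f : pcmor D D') :
  pcmor D D''.
Proof.
apply: (@PCMor D D'' (ghom_comp (morM g) (morM f)) (ghom_comp (morN g) (morN f))).
- by move=> x /=; rewrite !mor_bd.
- by move=> x h /=; rewrite !mor_act.
Defined.

Lemma mor_peiffer D D' (f : pcmor D D') x y :
  morM f (peiffer x y) = peiffer (morM f x) (morM f y).
Proof. by rewrite /peiffer !gmulfM !gmulfV mor_act mor_bd. Qed.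

Section Cr.
Variable D : precrossed.

Inductive is_peiffer : pcM D -> Prop := IsPeiffer x y : is_peiffer (peiffer x y).

(* M^cr *)
Definition crM : groupType := quotg is_peiffer.

Inductive is_commutator (G : groupType) : G -> Prop :=
  IsCommutator x y : is_commutator [~ x, y].

(* C = (M^cr)^ab, with the projection q : M -> C *)
Definition crC : groupType := quotg (@is_commutator crM).

Definition crq : {ghom pcM D -> crC} := ghom_comp quotg_pi quotg_pi.

Lemma crq_ind (P : crC -> Prop) : (forall x, P (crq x)) -> forall c, P c.
Proof. by move=> Pq; elim/quotg_ind=> c; elim/quotg_ind: c; apply: Pq. Qed.

Lemma crq_peiffer x y : crq (peiffer x y) = 1.
Proof.
have e : quotg_pi (peiffer x y) = 1 :> crM by apply: quotg_pi1.
by rewrite /crq ghom_compE e gmulf1.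
Qed.

Lemma crC_comm (c d : crC) : c * d = d * c.
Proof.
elim/quotg_ind: c => c; elim/quotg_ind: d => d.
by apply/commgP/eqP; rewrite -gmulfR quotg_pi1.
Qed.

Section Lift.
Variables (K : groupType) (f : {ghom pcM D -> K}).
Hypothesis fP : forall x y, f (peiffer x y) = 1.
Hypothesis fC : forall x y, f [~ x, y] = 1.

Let f1 x : is_peiffer x -> f x = 1. Proof. by case. Qed.
Let f2 c : is_commutator c -> quotg_lift f1 c = 1.
Proof.
case=> {}c d; elim/quotg_ind: c => x; elim/quotg_ind: d => y.
by rewrite -gmulfR quotg_lift_pi.
Qed.

Definition crC_lift : {ghom crC -> K} := quotg_lift f2.

Lemma crC_liftE x : crC_lift (crq x) = f x.
Proof. by rewrite /crC_lift quotg_lift_pi quotg_lift_pi. Qed.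
End Lift.
End Cr.
Arguments crq {D}.

Section CrMap.
Variables (D D' : precrossed) (m : {ghom pcM D -> pcM D'}).
Hypothesis mP : forall x y, m (peiffer x y) = peiffer (m x) (m y).

Let f := ghom_comp crq m.
Let fP x y : f (peiffer x y) = 1.
Proof. by rewrite /f ghom_compE mP crq_peiffer. Qed.
Let fC x y : f [~ x, y] = 1.
Proof. by rewrite gmulfR; apply/eqP/commgP/crC_comm. Qed.

(* The homomorphism C -> C' induced by m. *)
Definition crC_map : {ghom crC D -> crC D'} := crC_lift fP fC.

Lemma crC_mapE x : crC_map (crq x) = crq (m x).
Proof. exact: crC_liftE. Qed.
End CrMap.

(* phi_* : C -> C' *)
Definition pcmor_C (D D' : precrossed) (f : pcmor D D') : {ghom crC D -> crC D'} :=
  crC_map (mor_peiffer f).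

Lemma pcmor_CE D D' (f : pcmor D D') x : pcmor_C f (crq x) = crq (morM f x).
Proof. exact: crC_mapE. Qed.

Section ActionOnTensor.
Variable D : precrossed.
Local Notation C := (crC D).

Definition act_hom (g : pcN D) : {ghom pcM D -> pcM D} :=
  ghom_of (fun x y => gactMl pcact x y g).

Lemma act_hom_peiffer g (x y : pcM D) :
  act_hom g (peiffer x y) = peiffer (act_hom g x) (act_hom g y).
Proof.
rewrite /peiffer !gmulfM !gmulfV /= /act_hom /= bd_act -!gactM.
by rewrite !mulgA mulgV mul1g.
Qed.

Definition crC_act (c : C) (g : pcN D) : C := crC_map (act_hom_peiffer g) c.

Lemma crC_actE x g : crC_act (crq x) g = crq (pcact x g).
Proof. exact: crC_mapE. Qed.

(* The diagonal action of N on C (x) C. *)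
Definition tens_act_fun (t : tensor C C) (g : pcN D) : tensor C C :=
  tensor_map (crC_map (act_hom_peiffer g)) (crC_map (act_hom_peiffer g)) t.

Lemma tens_act_funE x y g : tens_act_fun (tens (crq x) (crq y)) g =
  tens (crq (pcact x g)) (crq (pcact y g)).
Proof. by rewrite /tens_act_fun tensor_mapE !crC_mapE. Qed.

Definition tens_act : gaction (pcN D) (tensor C C).
Proof.
apply: (@GAction _ _ tens_act_fun).
- apply: (@tensor_ext _ _ _ (tensor_map _ _) (ghom_id _)).
  by elim/crq_ind=> x; elim/crq_ind=> y; rewrite [LHS]tens_act_funE !gact1.
- move=> t g h; move: t.
  apply: (@tensor_ext _ _ _ (tensor_map _ _) (ghom_comp (tensor_map _ _) (tensor_map _ _))).
  elim/crq_ind=> x; elim/crq_ind=> y; rewrite [LHS]tens_act_funE.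
  by rewrite [RHS]ghom_compE 2!tensor_mapE !crC_mapE !ghom_ofE !gactM.
- by move=> s t g; apply: gmulfM.
Defined.
End ActionOnTensor.

Section W.
Variable D : nil2.
Local Notation M := (pcM D).
Implicit Types x y z : M.

Lemma nil2_l x y z : peiffer (peiffer x y) z = 1.
Proof. exact/(@nil2_P3 D)/sg_gen/peiffer3l. Qed.
Lemma nil2_r x y z : peiffer x (peiffer y z) = 1.
Proof. exact/(@nil2_P3 D)/sg_gen/peiffer3r. Qed.

Lemma act_bd x y : pcact y (bd x) = y ^ x * peiffer x y.
Proof. by rewrite /peiffer conjgE !mulgA !mulgK mulVg mul1g. Qed.

Lemma bd_peiffer x y : bd (peiffer x y) = 1 :> pcN D.
Proof.
by rewrite /peiffer !gmulfM !gmulfV bd_act !mulgA mulgK mulgVK mulVg.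
Qed.

Lemma peiffer_central x y z : commute (peiffer x y) z.
Proof.
have := act_bd (peiffer x y) z.
rewrite bd_peiffer gact1 nil2_l mulg1 => h.
by apply/commute_sym/commgP/conjg_fixP/esym.
Qed.

Lemma peiffer_act x y z : pcact (peiffer x y) (bd z) = peiffer x y.
Proof. by rewrite act_bd nil2_r mulg1; apply/conjg_fixP/commgP/peiffer_central. Qed.

Lemma peifferMr x y z : peiffer x (y * z) = peiffer x y * peiffer x z.
Proof.
apply: (mulgI ((y * z) ^ x)); rewrite -act_bd gactMl !act_bd conjMg.
suff swap (a b p q : M) : commute p b -> a * p * (b * q) = a * b * (p * q).
  exact/swap/peiffer_central.
by move=> pb; rewrite -!mulgA (mulgA p) pb -!mulgA.
Qed.

Definition peiffer_r x : {ghom M -> M} := ghom_of (peifferMr x).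

Lemma peiffer_conj x y z : peiffer x (y ^ z) = peiffer x y.
Proof.
rewrite -[LHS]/(peiffer_r x _) gmulfJ /=.
exact/conjg_fixP/commgP/peiffer_central.
Qed.

Lemma peifferMl x y z : peiffer (x * y) z = peiffer x z * peiffer y z.
Proof.
apply: (mulgI (z ^ (x * y))); rewrite -act_bd (gmulfM x y) gactM (act_bd x z) (gactMl pcact (z ^ x)).
rewrite peiffer_act act_bd peiffer_conj -conjgM -mulgA; congr (_ * _).
exact: peiffer_central.
Qed.

Definition peiffer_l y : {ghom M -> M} := ghom_of (fun x x' => peifferMl x x' y).

Lemma peiffer_commr x y z : peiffer x [~ y, z] = 1.
Proof.
rewrite -[LHS]/(peiffer_r x _) gmulfR.
exact/eqP/commgP/peiffer_central.
Qed.
Lemma peiffer_comml x y z : peiffer [~ x, y] z = 1.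
Proof.
rewrite -[LHS]/(peiffer_l z _) gmulfR.
exact/eqP/commgP/peiffer_central.
Qed.

Definition w_l (y : M) : {ghom crC D -> M} :=
  @crC_lift D M (peiffer_l y) (fun a b => nil2_l a b y)
    (fun a b => peiffer_comml a b y).

Lemma w_lM c y z : w_l (y * z) c = w_l y c * w_l z c.
Proof. by elim/crq_ind: c => x; rewrite !crC_liftE; apply: peifferMr. Qed.

Definition w_r (c : crC D) : {ghom M -> M} := ghom_of (w_lM c).

Lemma w_rE x y : w_r (crq x) y = peiffer x y.
Proof. by rewrite -[LHS]/(w_l y (crq x)) [LHS]crC_liftE. Qed.
Lemma w_r_peiffer c x y : w_r c (peiffer x y) = 1.
Proof. by elim/crq_ind: c => z; rewrite w_rE nil2_r. Qed.
Lemma w_r_comm c x y : w_r c [~ x, y] = 1.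
Proof. by elim/crq_ind: c => z; rewrite w_rE peiffer_commr. Qed.

Definition w_fun (c : crC D) : {ghom crC D -> M} :=
  crC_lift (w_r_peiffer c) (w_r_comm c).

Lemma w_funE x y : w_fun (crq x) (crq y) = peiffer x y.
Proof. by rewrite crC_liftE w_rE. Qed.

(* {x} (x) {y} |-> <x,y>, see wE *)
Definition w : {ghom tensor (crC D) (crC D) -> M}.
Proof.
apply: (@tensor_lift _ _ _ w_fun).
- elim/crq_ind=> x; elim/crq_ind=> y; elim/crq_ind=> z.
  by rewrite -gmulfM !w_funE peifferMl.
- by move=> c d e; apply: gmulfM.
- elim/crq_ind=> x; elim/crq_ind=> y; elim/crq_ind=> x'; elim/crq_ind=> y'.
  by rewrite !w_funE; apply: peiffer_central.
Defined.

Lemma wE x y : w (tens (crq x) (crq y)) = peiffer x y.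
Proof. by rewrite /w tensor_liftE w_funE. Qed.
End W.
Arguments w {D}.

Record quadmod := QuadMod {
  qbase : nil2;
  qL : groupType;
  qact : gaction (pcN qbase) qL;
  qom : {ghom tensor (crC qbase) (crC qbase) -> qL};
  qdl : {ghom qL -> pcM qbase};
  qom_act : forall t g, qom (tens_act qbase t g) = qact (qom t) g;
  qdl_act : forall a g, qdl (qact a g) = pcact (qdl a) g;
  qm1 : forall a, bd (qdl a) = 1;
  qm2 : forall x y : pcM qbase,
    qdl (qom (tens (crq x) (crq y))) = w (tens (crq x) (crq y));
  qm3 : forall (a : qL) (x : pcM qbase),
    qom (tens (crq (qdl a)) (crq x) * tens (crq x) (crq (qdl a)))
      = a^-1 * qact a (bd x);
  qm4 : forall a b : qL, qom (tens (crq (qdl a)) (crq (qdl b))) = [~ a, b]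
}.
Arguments qact {q}.
Arguments qom {q}.
Arguments qdl {q}.

Record quadmor (Q Q' : quadmod) := QuadMor {
  qmbase : pcmor (qbase Q) (qbase Q');
  qmL : {ghom qL Q -> qL Q'};
  qmL_act : forall a g, qmL (qact a g) = qact (qmL a) (morN qmbase g);
  qmL_om : forall t,
    qmL (qom t) = qom (tensor_map (pcmor_C qmbase) (pcmor_C qmbase) t);
  qmL_dl : forall a, qdl (qmL a) = morM qmbase (qdl a)
}.

Lemma quadmor_eq Q Q' (f f' : quadmor Q Q') :
  qmbase f = qmbase f' -> qmL f =1 qmL f' -> f = f'.
Proof.
case: f f' => [b l h1 h2 h3] [b' l' h1' h2' h3'] /= bb /ghom_eq ll.
by subst b' l'; congr QuadMor; apply: Prop_irrelevance.
Qed.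

Lemma pcmor_C2_id (D : precrossed) t :
  tensor_map (pcmor_C (pcmor_id D)) (pcmor_C (pcmor_id D)) t = t.
Proof.
move: t; apply: (@tensor_ext _ _ _ (tensor_map _ _) (ghom_id _)).
by elim/crq_ind=> x; elim/crq_ind=> y; rewrite tensor_mapE !pcmor_CE.
Qed.

Lemma pcmor_C2_comp D D' D'' (g : pcmor D' D'') (f : pcmor D D') t :
  tensor_map (pcmor_C (pcmor_comp g f)) (pcmor_C (pcmor_comp g f)) t =
  tensor_map (pcmor_C g) (pcmor_C g) (tensor_map (pcmor_C f) (pcmor_C f) t).
Proof.
move: t; apply: (@tensor_ext _ _ _ (tensor_map _ _)
  (ghom_comp (tensor_map _ _) (tensor_map _ _))).
by elim/crq_ind=> x; elim/crq_ind=> y; rewrite [RHS]ghom_compE !tensor_mapE !pcmor_CE.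
Qed.

Definition quadmor_id (Q : quadmod) : quadmor Q Q.
Proof.
apply: (@QuadMor Q Q (pcmor_id _) (ghom_id _)) => // t.
by rewrite pcmor_C2_id.
Defined.

Definition quadmor_comp (Q Q' Q'' : quadmod)
  (g : quadmor Q' Q'') (f : quadmor Q Q') : quadmor Q Q''.
Proof.
apply: (@QuadMor Q Q'' (pcmor_comp (qmbase g) (qmbase f))
  (ghom_comp (qmL g) (qmL f))).
- by move=> a h /=; rewrite !qmL_act.
- by move=> t; rewrite pcmor_C2_comp -!qmL_om.
- by move=> a /=; rewrite !qmL_dl.
Defined.

Record category := Category {
  obj :> Type;
  hom : obj -> obj -> Type;
  idm : forall x, hom x x;
  compm : forall x y z, hom y z -> hom x y -> hom x z;
  compm1 : forall x y (f : hom x y), compm f (idm x) = f;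
  comp1m : forall x y (f : hom x y), compm (idm y) f = f;
  compmA : forall x y z t (h : hom z t) (g : hom y z) (f : hom x y),
    compm h (compm g f) = compm (compm h g) f
}.
Arguments hom {c}.
Arguments idm {c}.
Arguments compm {c x y z}.

Record functor (X B : category) := Functor {
  fobj :> X -> B;
  fmap : forall x y, hom x y -> hom (fobj x) (fobj y);
  fmap1 : forall x, fmap (idm x) = idm (fobj x);
  fmapM : forall x y z (g : hom y z) (f : hom x y),
    fmap (compm g f) = compm (fmap g) (fmap f)
}.
Arguments fmap {X B} _ {x y} _.

Definition cartesian (X B : category) (Phi : functor X B) (Y X0 : X)
    (phi : hom Y X0) : Prop :=
  forall (Z : X) (v : hom (Phi Z) (Phi Y)) (theta : hom Z X0),
    fmap Phi theta = compm (fmap Phi phi) v ->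
    exists! psi : hom Z Y, fmap Phi psi = v /\ theta = compm phi psi.

Definition cast_dom (B : category) (I J K : B) (e : I = J) (f : hom I K) : hom J K :=
  match e in _ = J' return hom J' K with erefl => f end.

(* phi lies strictly over u: its source Y satisfies Phi Y = J, and the cast
   along this equality turns Phi phi into u. *)
Definition fibration (X B : category) (Phi : functor X B) : Prop :=
  forall (J : B) (X0 : X) (u : hom J (Phi X0)),
    exists (Y : X) (e : Phi Y = J) (phi : hom Y X0),
      cast_dom e (fmap Phi phi) = u /\ cartesian Phi phi.

Record adjunction (X B : category) (F : functor B X) (Phi : functor X B) :=
  Adjunction {
  adj : forall b x, hom (F b) x -> hom b (Phi x);
  adj_bij : forall b x, bijective (@adj b x);
  adj_nat : forall b b' x x' (u : hom b' b) (f : hom (F b) x) (g : hom x x'),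
    adj (compm (compm g f) (fmap F u)) = compm (compm (fmap Phi g) (adj f)) u
}.

Definition has_left_adjoint (X B : category) (Phi : functor X B) : Prop :=
  exists F : functor B X, inhabited (adjunction F Phi).

Fact pcmor_compm1 D D' (f : pcmor D D') : pcmor_comp f (pcmor_id D) = f.
Proof. exact: pcmor_eq. Qed.
Fact pcmor_comp1m D D' (f : pcmor D D') : pcmor_comp (pcmor_id D') f = f.
Proof. exact: pcmor_eq. Qed.
Fact pcmor_compmA D1 D2 D3 D4 (h : pcmor D3 D4) (g : pcmor D2 D3) (f : pcmor D1 D2) :
  pcmor_comp h (pcmor_comp g f) = pcmor_comp (pcmor_comp h g) f.
Proof. exact: pcmor_eq. Qed.

Definition Nil2 : category := {|
  obj := nil2;
  hom D D' := pcmor D D';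
  idm D := pcmor_id D;
  compm _ _ _ g f := pcmor_comp g f;
  compm1 D D' := @pcmor_compm1 D D';
  comp1m D D' := @pcmor_comp1m D D';
  compmA D1 D2 D3 D4 := @pcmor_compmA D1 D2 D3 D4
|}.

Fact quadmor_compm1 Q Q' (f : quadmor Q Q') : quadmor_comp f (quadmor_id Q) = f.
Proof. by apply: quadmor_eq => //; apply: pcmor_eq. Qed.
Fact quadmor_comp1m Q Q' (f : quadmor Q Q') : quadmor_comp (quadmor_id Q') f = f.
Proof. by apply: quadmor_eq => //; apply: pcmor_eq. Qed.
Fact quadmor_compmA Q1 Q2 Q3 Q4
    (h : quadmor Q3 Q4) (g : quadmor Q2 Q3) (f : quadmor Q1 Q2) :
  quadmor_comp h (quadmor_comp g f) = quadmor_comp (quadmor_comp h g) f.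
Proof. by apply: quadmor_eq => //; apply: pcmor_eq. Qed.

Definition Quad : category := {|
  obj := quadmod;
  hom := quadmor;
  idm := quadmor_id;
  compm := quadmor_comp;
  compm1 := quadmor_compm1;
  comp1m := quadmor_comp1m;
  compmA := quadmor_compmA
|}.

Definition forget_Quad : functor Quad Nil2 :=
  @Functor Quad Nil2 qbase qmbase (fun=> erefl) (fun _ _ _ _ _ => erefl).

(* Main.v *)
Require Import Defs.
From HB Require Import structures.
From mathcomp Require Import all_boot boolp.

(** Fibration: let [u : D -> D'] be a morphism of nil(2)-modules and [Q] a
quadratic module on [D'] with top group [L'].  The cartesian lift of [u] has as
top group the fibre product over [M'] of [Ker (bd : M -> N)] and [L'], that is,
the pairs [(x, a)] with [bd x = 1] and [qdl a = morM u x].  Its [qdl] is the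
first projection, which forces the first coordinate of [qom t] to be [w t]; the
second one is the value at [t] of the [qom] of [Q] transported along [u].  Each
axiom then splits into two coordinates.  The second coordinate is an axiom of
[Q].  The first is an identity in [M] between elements of [Ker bd], where
Peiffer commutators degenerate: if [bd x = 1], then [<x, y>] is the ordinary
commutator [[~ x, y]], whence the fourth axiom, and
[<x, y><y, x> = x^-1 x^(bd y)], whence the third.  Cartesianness is the
universal property of the fibre product: a morphism into the lift has
its first coordinate prescribed by compatibility with [qdl], its second one by
the composite with the projection to [Q].

Left adjoint: the free quadratic module on a nil(2)-module [D] is
[C (x) C -> M -> N] with [qom] the identity and [qdl = w].  The last two axioms
hold because both of their sides are trivial: the values of [w] are products of
Peiffer commutators and their inverses, which die in [C]; [C (x) C] is commutative; and [bd x]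
acts trivially on [C], since [y ^ (bd x)] is the conjugate [x^-1 y x] up to a
Peiffer commutator.  A morphism from it to [Q] over a given [u] is determined
by [l \o qom = qom \o (u (x) u)], as [qom] is the identity, and this formula
does define a morphism, so that morphisms from the free module to [Q] are
morphisms from [D] to the base of [Q]. *)

Set Implicit Arguments.
Unset Strict Implicit.
Unset Printing Implicit Defensive.

Local Open Scope group_scope.

(** * The tensor square of C and the homomorphism w *)

Lemma tens1l (A B : groupType) (b : B) : tens (1 : A) b = 1.
Proof. by apply: (mulgI (tens 1 b)); rewrite -tensMl !mulg1. Qed.

Lemma tens1r (A B : groupType) (a : A) : tens a (1 : B) = 1.
Proof. by apply: (mulgI (tens a 1)); rewrite -tensMr !mulg1. Qed.

(** Homomorphisms out of [C (x) C] are tested on the images of pairs of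
elements of [M], on which everything below has an explicit formula. *)
Lemma tensor_crq_ext (D : precrossed) (K : groupType)
    (f g : {ghom tensor (crC D) (crC D) -> K}) :
  (forall x y, f (tens (crq x) (crq y)) = g (tens (crq x) (crq y))) -> f =1 g.
Proof.
by move=> fg; apply: tensor_ext; elim/crq_ind=> x; elim/crq_ind=> y; apply: fg.
Qed.

Definition tens_act_hom (D : precrossed) (g : pcN D) :
    {ghom tensor (crC D) (crC D) -> tensor (crC D) (crC D)} :=
  ghom_of (fun s t => gactMl (tens_act D) s t g).

(** [y ^ (bd x)] is a conjugate of [y] times a Peiffer commutator. *)
Lemma crq_act_bd (D : precrossed) (x y : pcM D) :
  crq (pcact y (bd x)) = crq y.
Proof.
have -> : pcact y (bd x) = y ^ x * peiffer x y.
  by rewrite /peiffer conjgE !mulgA !mulgK mulVg mul1g.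
rewrite gmulfM crq_peiffer mulg1 gmulfJ.
exact/conjg_fixP/commgP/crC_comm.
Qed.

Lemma tens_act_bd (D : precrossed) (x : pcM D) t : tens_act D t (bd x) = t.
Proof.
move: t; apply: (@tensor_crq_ext _ _ (tens_act_hom (bd x)) (ghom_id _)) => y z.
by rewrite [LHS]tens_act_funE !crq_act_bd.
Qed.

Lemma pcmor_C2E (D D' : precrossed) (u : pcmor D D') x y :
  tensor_map (pcmor_C u) (pcmor_C u) (tens (crq x) (crq y)) =
  tens (crq (morM u x)) (crq (morM u y)).
Proof. by rewrite tensor_mapE !pcmor_CE. Qed.

Lemma pcmor_C2_act (D D' : precrossed) (u : pcmor D D') t g :
  tensor_map (pcmor_C u) (pcmor_C u) (tens_act D t g) =
  tens_act D' (tensor_map (pcmor_C u) (pcmor_C u) t) (morN u g).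
Proof.
move: t; apply: (@tensor_crq_ext _ _
  (ghom_comp (tensor_map _ _) (tens_act_hom g))
  (ghom_comp (tens_act_hom (morN u g)) (tensor_map _ _))) => x y.
rewrite !ghom_compE pcmor_C2E [tens_act_hom g _]tens_act_funE pcmor_C2E.
by rewrite [RHS]tens_act_funE !mor_act.
Qed.

Lemma w_act (D : nil2) t (g : pcN D) : w (tens_act D t g) = pcact (w t) g.
Proof.
move: t; apply: (@tensor_crq_ext _ _
  (ghom_comp w (tens_act_hom g)) (ghom_comp (act_hom g) w)) => x y.
rewrite !ghom_compE [tens_act_hom g _]tens_act_funE !wE.
exact/esym/act_hom_peiffer.
Qed.

Lemma bd_w (D : nil2) t : bd (w t) = 1 :> pcN D.
Proof.
elim/tensor_ind: t => [a b||s t ws wt|t wt].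
- by elim/crq_ind: a => x; elim/crq_ind: b => y; rewrite wE bd_peiffer.
- by rewrite !gmulf1.
- by rewrite !gmulfM ws wt mulg1.
- by rewrite !gmulfV wt invg1.
Qed.

Lemma crq_w (D : nil2) t : crq (w t) = 1 :> crC D.
Proof.
elim/tensor_ind: t => [a b||s t ws wt|t wt].
- by elim/crq_ind: a => x; elim/crq_ind: b => y; rewrite wE crq_peiffer.
- by rewrite !gmulf1.
- by rewrite !gmulfM ws wt mulg1.
- by rewrite !gmulfV wt invg1.
Qed.

Lemma w_nat (D D' : nil2) (u : pcmor D D') t :
  morM u (w t) = w (tensor_map (pcmor_C u) (pcmor_C u) t).
Proof.
move: t; apply: (@tensor_crq_ext _ _
  (ghom_comp (morM u) w) (ghom_comp w (tensor_map _ _))) => x y.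
by rewrite !ghom_compE pcmor_C2E !wE mor_peiffer.
Qed.

Lemma qdl_qom (Q : quadmod) t : qdl (qom t) = w t :> pcM (qbase Q).
Proof.
move: t; apply: (@tensor_crq_ext _ _ (ghom_comp qdl qom) w) => x y.
exact: qm2.
Qed.

(** The two identities in the kernel of [bd] behind the last two axioms of the
cartesian lift. *)
Lemma peiffer_kerl (D : precrossed) (x y : pcM D) :
  bd x = 1 -> peiffer x y = [~ x, y].
Proof. by move=> x1; rewrite /peiffer x1 gact1 commgEl conjgE !mulgA. Qed.

Lemma peiffer_ker_mulC (D : precrossed) (x y : pcM D) :
  bd x = 1 -> peiffer x y * peiffer y x = x^-1 * pcact x (bd y).
Proof.
by move=> x1; rewrite /peiffer x1 gact1 !mulgA mulgK mulgK mulgVK.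
Qed.

(** * The cartesian lift *)

Section Lift.
Variables (D : nil2) (Q : quadmod) (u : pcmor D (qbase Q)).

(** The condition [bd p.1 = 1] cannot be deduced from the other one: the axioms
of [Q] only give [morN u (bd p.1) = 1], and [morN u] need not be injective. *)
Definition lift_pred : pred (pcM D * qL Q) :=
  fun p => `[< bd p.1 = 1 /\ qdl p.2 = morM u p.1 >].

Fact lift_group_closed : group_closed lift_pred.
Proof.
split=> [|p q /asboolP[p1 pu] /asboolP[q1 qu]]; apply/asboolP.
  by rewrite !gmulf1.
by rewrite !gmulfF p1 q1 pu qu mulgV.
Qed.

Record lift_sort := LiftPair { lift_val : pcM D * qL Q; _ : lift_pred lift_val }.

HB.instance Definition _ := [isSub for lift_val].
HB.instance Definition _ := [Choice of lift_sort by <:].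
HB.instance Definition _ :=
  SubChoice_isSubGroup.Build _ _ lift_sort lift_group_closed.

Definition liftL : groupType := lift_sort.

Lemma liftP (a : liftL) : bd (val a).1 = 1 /\ qdl (val a).2 = morM u (val a).1.
Proof. exact/asboolP/(valP a). Qed.

Lemma lift_inj (a b : liftL) :
  (val a).1 = (val b).1 -> (val a).2 = (val b).2 -> a = b.
Proof.
move=> e1 e2; apply: val_inj.
by rewrite [LHS]surjective_pairing e1 e2 -surjective_pairing.
Qed.

Section Pairing.
Variables (K : groupType) (f : {ghom K -> pcM D}) (h : {ghom K -> qL Q}).
Hypotheses (f1 : forall k, bd (f k) = 1)
           (hf : forall k, qdl (h k) = morM u (f k)).

Fact lift_pair_subproof k : lift_pred (f k, h k).
Proof. by apply/asboolP; split; [apply: f1 | apply: hf]. Qed.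

Definition lift_pair_fun k : liftL := LiftPair (lift_pair_subproof k).

Fact lift_pair_funM : {morph lift_pair_fun : k l / k * l}.
Proof.
by move=> k l; apply: val_inj; rewrite valM /= !gmulfM.
Qed.

Definition lift_pair : {ghom K -> liftL} := ghom_of lift_pair_funM.
End Pairing.

Fact lift_fstM : {morph (fun a : liftL => (val a).1) : a b / a * b}.
Proof. by move=> a b; rewrite valM. Qed.
Definition lift_fst : {ghom liftL -> pcM D} := ghom_of lift_fstM.

Fact lift_sndM : {morph (fun a : liftL => (val a).2) : a b / a * b}.
Proof. by move=> a b; rewrite valM. Qed.
Definition lift_snd : {ghom liftL -> qL Q} := ghom_of lift_sndM.

Fact lift_act_subproof (a : liftL) (g : pcN D) :
  lift_pred (pcact (val a).1 g, qact (val a).2 (morN u g)).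
Proof.
have [a1 au] := liftP a.
by apply/asboolP; rewrite /= bd_act a1 mulg1 mulVg qdl_act au mor_act.
Qed.

Definition lift_act : gaction (pcN D) liftL.
Proof.
apply: (@GAction _ _ (fun a g => LiftPair (lift_act_subproof a g) : liftL)).
- by move=> a; apply: lift_inj; rewrite /= ?gmulf1 gact1.
- by move=> a g h; apply: lift_inj; rewrite /= ?gmulfM gactM.
- by move=> a b g; apply: lift_inj; apply: gactMl.
Defined.

Definition lift_om : {ghom tensor (crC D) (crC D) -> liftL}.
Proof.
apply: (@lift_pair _ w (ghom_comp qom (tensor_map (pcmor_C u) (pcmor_C u)))).
- exact: bd_w.
- by move=> t; rewrite ghom_compE qdl_qom w_nat.
Defined.

Lemma lift_om_fst t : (val (lift_om t)).1 = w t. Proof. by []. Qed.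
Lemma lift_om_snd t :
  (val (lift_om t)).2 = qom (tensor_map (pcmor_C u) (pcmor_C u) t).
Proof. by []. Qed.

Definition lift_quad : quadmod.
Proof.
apply: (@QuadMod D liftL lift_act lift_om lift_fst).
- move=> t g; apply: lift_inj; first exact: w_act.
  by rewrite lift_om_snd pcmor_C2_act qom_act.
- by [].
- by move=> a; have [] := liftP a.
- by [].
- move=> a x; have [a1 au] := liftP a; apply: lift_inj.
    rewrite lift_om_fst gmulfM !wE; exact: peiffer_ker_mulC.
  rewrite lift_om_snd gmulfM !pcmor_C2E -au qm3 -mor_bd.
  by rewrite -[RHS]/(lift_snd _) gmulfM gmulfV.
- move=> a b; have [[a1 au] [b1 bu]] := (liftP a, liftP b); apply: lift_inj.
    by rewrite -[RHS]/(lift_fst _) gmulfR lift_om_fst wE peiffer_kerl.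
  by rewrite -[RHS]/(lift_snd _) gmulfR lift_om_snd pcmor_C2E -au -bu qm4.
Defined.

Definition lift_mor : quadmor lift_quad Q.
Proof.
apply: (@QuadMor lift_quad Q u lift_snd) => // a.
by have [] := liftP a.
Defined.

(** The base of a morphism [psi : Z -> lift_quad] is prescribed, and so is its
top component: compatibility with [qdl] gives the first coordinate
[morM v (qdl a)], and [theta = lift_mor \o psi] the second one.  These two
satisfy the conditions defining the fibre product because [bd \o qdl = 1] in
[Z] and because [theta] lies over [u \o v]. *)
Lemma lift_cartesian :
  @cartesian Quad Nil2 forget_Quad lift_quad Q lift_mor.
Proof.
move=> Z v theta /= thetaE.
have psi1 (a : qL Z) : bd (ghom_comp (morM v) qdl a) = 1.
  by rewrite ghom_compE -mor_bd qm1 gmulf1.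
have psi2 (a : qL Z) : qdl (qmL theta a) = morM u (ghom_comp (morM v) qdl a).
  by rewrite qmL_dl thetaE.
pose l : {ghom qL Z -> qL lift_quad} := lift_pair psi1 psi2.
have lact a g : l (qact a g) = qact (l a) (morN v g).
  apply: lift_inj; rewrite /= ?qdl_act ?mor_act //.
  by rewrite qmL_act thetaE.
have lom t : l (qom t) = qom (tensor_map (pcmor_C v) (pcmor_C v) t).
  apply: lift_inj; first by rewrite /= qdl_qom w_nat.
  by rewrite /= qmL_om thetaE pcmor_C2_comp.
pose psi : quadmor Z lift_quad := @QuadMor Z lift_quad v l lact lom (fun=> erefl).
exists psi; split=> [|psi' [psi'v thetapsi']].
  by split=> //; apply: quadmor_eq.
apply: quadmor_eq => [//|a]; apply: lift_inj => /=.
  by have := qmL_dl psi' a; rewrite psi'v => <-.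
by rewrite thetapsi'.
Qed.
End Lift.

Lemma forget_Quad_fibration : fibration forget_Quad.
Proof.
(* The base of [lift_quad u] is [D] by computation, so the cast is trivial. *)
move=> D Q u; exists (lift_quad u), erefl, (lift_mor u).
by split; last exact: lift_cartesian.
Qed.

(** * The free quadratic module *)

Definition free_quad (D : nil2) : quadmod.
Proof.
apply: (@QuadMod D _ (tens_act D) (ghom_id _) w) => //.
- by move=> t g; rewrite w_act.
- exact: bd_w.
- by move=> t x; rewrite crq_w tens1l tens1r tens_act_bd mulg1 mulVg.
- move=> s t; rewrite !crq_w tens1l.
  exact/esym/eqP/commgP/tensorC.
Defined.

Definition free_adj_inv (D : nil2) (Q : quadmod) (u : pcmor D (qbase Q)) :
  quadmor (free_quad D) Q.
Proof.
apply: (@QuadMor (free_quad D) Q u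
  (ghom_comp qom (tensor_map (pcmor_C u) (pcmor_C u)))) => //.
- by move=> t g; rewrite !ghom_compE [qact t g]/= pcmor_C2_act qom_act.
- by move=> t; rewrite ghom_compE qdl_qom w_nat.
Defined.

(** As [qom] is the identity in [free_quad D], compatibility with [qom] is an
explicit formula for the top component.  All functoriality and bijectivity
statements about [free_quad] follow from this injectivity. *)
Lemma qmbase_free_inj (D : nil2) (Q : quadmod) :
  injective (@qmbase (free_quad D) Q).
Proof.
move=> f f' ff'; apply: quadmor_eq => // t.
by rewrite (qmL_om f t) (qmL_om f' t) ff'.
Qed.

Definition free_map (D D' : nil2) (u : pcmor D D') :
  quadmor (free_quad D) (free_quad D') := @free_adj_inv D (free_quad D') u.

Definition free_functor : functor Nil2 Quad.
Proof.
apply: (@Functor Nil2 Quad free_quad free_map).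
- by move=> D; apply: qmbase_free_inj.
- by move=> D D' D'' v u; apply: qmbase_free_inj.
Defined.

Lemma forget_Quad_left_adjoint : has_left_adjoint forget_Quad.
Proof.
exists free_functor; constructor.
apply: (@Adjunction Quad Nil2 free_functor forget_Quad
  (fun D Q => @qmbase (free_quad D) Q)) => [D Q|//].
by exists (@free_adj_inv D Q) => // f; apply: qmbase_free_inj.
Qed.

Theorem proposition3p2 :
  fibration forget_Quad /\ has_left_adjoint forget_Quad.
Proof. exact: (conj forget_Quad_fibration forget_Quad_left_adjoint). Qed.
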